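(* For $n\ge1$ let $N=2^n$ and let $G_N=(V_N,E_N)$ be the $n$-dimensional hypercube: $V_N=\{0,1\}^n$, with edges connecting any two points that differ in exactly one coordinate. Put i.i.d. heavy-tailed weights on the vertices as described in the context. Let $\ell_N=\log_2(N)/10=n/10$. Then: (i) if $\mathfrak x,\mathfrak y$ are chosen independently and uniformly in $V_N$, then $\lim_{N\to\infty}\mathbb P[(\mathfrak x,B(\mathfrak x,\ell_N))\not\equiv(\mathfrak y,B(\mathfrak y,\ell_N))]=0$; (ii) for every increasing sequence of integers $J_N$ with $J_N\to\infty$, $\lim_{N\to\infty}\mathbb E[\nu_N(\{x^N_1,\dots,x^N_{\min\{J_N,|V_N|\}}\}^c)]=0$; (iii) for $\mathfrak x$ uniform in $V_N$, $\lim_{N\to\infty}\mathbb E[|B(\mathfrak x,2\ell_N)|/|V_N|]=0$; (iv) there is an increasing sequence $L_N\to\infty$ such that, for $\mathfrak x$ uniform in $V_N$, $\lim_{N\to\infty}\mathbb E\big[\sup_{y\notin B(\mathfrak x,\ell_N)}\mathbf P^N_y[\mathbb H_{\mathfrak x}\le L_Nt^N_{\mathrm{mix}}]\big]=0$.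
   Context: Limits are along $N=2^n$, $n\to\infty$. Weights: $\{W^N_j:j\ge1\}$ are i.i.d. strictly positive random variables with law not depending on $N$ and $\mathbb P[W^N_1>t]=L(t)t^{-\alpha}$, $t>0$, where $0<\alpha<1$ and $L$ is slowly varying at infinity. $\hat W^N_1\ge\dots\ge\hat W^N_{|V_N|}$ is the decreasing rearrangement of $W^N_1,\dots,W^N_{|V_N|}$, $(x^N_1,\dots,x^N_{|V_N|})$ is an independent uniformly random enumeration of $V_N$, and $W^N_{x^N_j}=\hat W^N_j$. $\nu_N(x)=\deg(x)W^N_x/\sum_{y\in V_N}\deg(y)W^N_y$. $B(x,\ell)$ is the ball of radius $\ell$ about $x$ in graph distance. $\mathbf P^N_x$ is the law of the lazy discrete-time random walk on $G_N$ started at $x$ (stay with probability $1/2$, otherwise jump to a uniform neighbor); $\mathbb H_x$ is its hitting time of $x$; $t^N_{\mathrm{mix}}$ is its mixing time, i.e. the least $t$ such that the maximum over starting points of the total variation distance between the law at time $t$ and the stationary law is at most $1/4$. $(\mathfrak x,A)\equiv(\mathfrak y,B)$, for $\mathfrak x\in A\subset V_N$, $\mathfrak y\in B\subset V_N$, means there is a bijection $\varphi:A\to B$ with $\varphi(\mathfrak x)=\mathfrak y$ such that $\{a,b\}\in E_N$ iff $\{\varphi(a),\varphi(b)\}\in E_N$ for all $a,b\in A$. *)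

(* Defs.v *)
(* MathComp / MathComp-Analysis; the reals are an arbitrary R : realType. *)
From HB Require Import structures.
From mathcomp Require Export all_boot all_order all_algebra.
From mathcomp Require Export all_classical all_reals all_analysis.

Set Implicit Arguments.
Unset Strict Implicit.
Unset Printing Implicit Defensive.

Export Order.TTheory GRing.Theory Num.Theory.
Export numFieldNormedType.Exports.

#[export] Set Implicit Arguments.
#[export] Unset Strict Implicit.
#[export] Unset Printing Implicit Defensive.

Local Open Scope classical_set_scope.
Local Open Scope ring_scope.

(** * Finite graphs, given by an adjacency relation [e : rel V] *)

Section Graph.
Context {R : realType} {V : finType}.
Variable e : rel V.

Definition deg (x : V) : nat := #|[set y | e x y]%SET|.

(* +oo when no path joins x to y *)
Definition gdist (x y : V) : \bar R :=
  ereal_inf [set (size p)%:R%:E | p in [set p : seq V | path e x p /\ last x p = y]].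

Definition gball (x : V) (r : R) : {set V} := [set y | (gdist x y <= r%:E)%E]%SET.

(* The bijection A -> B is a map on V, of which only the restriction to A is
   constrained. *)
Definition rooted_equiv (x : V) (A : {set V}) (y : V) (B : {set V}) : Prop :=
  exists phi : V -> V,
    [/\ {in A &, injective phi}, phi @: A = B, phi x = y &
        {in A &, forall a b, e a b = e (phi a) (phi b)}].

(* One-step transition probabilities of the lazy simple random walk. *)
Definition lazy_step (x y : V) : R :=
  (x == y)%:R / 2 + (e x y)%:R / (2 * (deg x)%:R).

Definition stationary (y : V) : R := (deg y)%:R / (\sum_x deg x)%:R.

Fixpoint lazy_law (x : V) (t : nat) (y : V) : R :=
  if t is t'.+1 then \sum_z lazy_law x t' z * lazy_step z y else (x == y)%:R.

Definition tv_dist (p q : V -> R) : R :=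
  \big[Num.max/0]_(A : {set V}) `|\sum_(y in A) p y - \sum_(y in A) q y|.

(* The infimum of a nonempty set of natural numbers is its least element; it is
   +oo if the walk never mixes. *)
Definition mixing_time : \bar R :=
  ereal_inf [set t%:R%:E | t in [set t : nat |
    \big[Num.max/0]_x tv_dist (lazy_law x t) stationary <= 1 / 4]].

Lemma stationaryP (y : V) : symmetric e ->
  \sum_x stationary x * lazy_step x y = stationary y.
Proof.
move=> es; rewrite /lazy_step.
under eq_bigr do rewrite mulrDr.
rewrite big_split /= (bigD1 y) //= eqxx big1 ?addr0; last first.
  by move=> x /negPf ->; rewrite mul0r mulr0.
have -> : \sum_x stationary x * ((e x y)%:R / (2 * (deg x)%:R)) =
          stationary y / 2.
  rewrite [in RHS]/stationary [X in (X)%:R / _]/deg -sum1_card natr_sum !mulr_suml.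
  rewrite [RHS]big_mkcond /=.
  apply: eq_bigr => x _; rewrite inE es; case: ifP => [exy|_]; last first.
    by rewrite mul0r mulr0.
  have dx : (deg x)%:R != 0 :> R.
    by rewrite pnatr_eq0 -lt0n; apply/card_gt0P; exists y; rewrite inE es.
  move: dx; rewrite /stationary; move: (deg x)%:R (\sum_x0 deg x0)%:R^-1 => D i D0.
  by rewrite /= !mul1r invfM [D * i]mulrC -mulrA [D * _]mulrCA divff // mulr1.
by rewrite /= mul1r -mulrDr -[_^-1]mul1r -splitr mulr1.
Qed.

End Graph.

(** * Random elements *)

Section Random.
Context {d : measure_display} {Om : measurableType d} {R : realType}.
Variable P : probability Om R.

(* Random elements of a finite set, which carries its discrete sigma-algebra. *)
Definition random_element (U : finType) (X : Om -> U) : Prop :=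
  forall A : set U, measurable (X @^-1` A).

Definition uniform_element (U : finType) (X : Om -> U) : Prop :=
  random_element X /\ forall u, P (X @^-1` [set u]) = (#|U|%:R^-1)%:E.

Definition independent_elements (U U' : finType) (X : Om -> U) (Y : Om -> U') : Prop :=
  forall A B, P (X @^-1` A `&` Y @^-1` B) = (P (X @^-1` A) * P (Y @^-1` B))%E.

Definition mutually_independent (W : nat -> Om -> R) : Prop :=
  forall (s : seq nat) (A : nat -> set R), uniq s ->
    (forall j, measurable (A j)) ->
    P (\bigcap_(j in [set` s]) W j @^-1` A j) =
    (\prod_(j <- s) P (W j @^-1` A j))%E.

Definition iid (W : nat -> Om -> R) : Prop :=
  mutually_independent W /\
  forall i j A, measurable A -> P (W i @^-1` A) = P (W j @^-1` A).

Definition generated_sigma_algebra (W : nat -> Om -> R) : set (set Om) :=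
  <<s [set W j @^-1` A | j in setT & A in measurable] >>.

Definition independent_of_family (U : finType) (X : Om -> U) (W : nat -> Om -> R) :
    Prop :=
  forall (A : set U) (B : set Om), generated_sigma_algebra W B ->
    P (X @^-1` A `&` B) = (P (X @^-1` A) * P B)%E.

(* Law P of a Markov chain S with transition probabilities p, started at x. *)
Definition is_markov_chain (V : finType) (p : V -> V -> R) (x : V)
    (S : nat -> Om -> V) : Prop :=
  (forall k, random_element (S k)) /\
  forall (m : nat) (z : nat -> V),
    P [set om | forall k, (k <= m)%N -> S k om = z k] =
    ((x == z 0%N)%:R * \prod_(k < m) p (z k) (z k.+1))%:E.

End Random.

(* +oo if x is never hit *)
Definition hitting_time {R : realType} {Om : Type} {V : eqType}
    (S : nat -> Om -> V) (x : V) (om : Om) : \bar R :=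
  ereal_inf [set k%:R%:E | k in [set k : nat | S k om = x]].

(* Positive measurable on a neighbourhood of infinity, in Karamata's sense. *)
Definition slowly_varying {R : realType} (L : R -> R) : Prop :=
  (exists2 a : R, measurable_fun `[a, +oo[ L & forall t, a <= t -> 0 < L t) /\
  forall c : R, 0 < c -> L (c * t) / L t @[t --> +oo] --> (1 : R).

(** * Weights on the vertices of a finite graph *)

(* Enumerations of V, the j-th vertex being [val x j] with j counted from 0: an
   injection from 'I_#|V| to V is a bijection. *)
Definition enumeration (V : finType) : finType :=
  {f : {ffun 'I_#|V| -> V} | injectiveb f}.

Section Weights.
Context {R : realType} {V : finType}.
Variable e : rel V.

(* [w j] stands for the weight of index j + 1. *)
Definition decreasing_rearrangement (w : nat -> R) : seq R :=
  sort >=%O (mkseq w #|V|).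

(* The weight at the j-th vertex of the enumeration is the j-th largest weight. *)
Definition vertex_weight (w : nat -> R) (x : enumeration V) (v : V) : R :=
  nth 0 (decreasing_rearrangement w) (index v (codom (val x))).

Definition nu (w : nat -> R) (x : enumeration V) (A : {set V}) : R :=
  \sum_(v in A) ((deg e v)%:R * vertex_weight w x v /
                 \sum_y (deg e y)%:R * vertex_weight w x y).

Definition first_vertices (x : enumeration V) (m : nat) : {set V} :=
  [set val x j | j in [set j : 'I_#|V| | (j < m)%N]]%SET.

End Weights.

(** * The hypercube *)

Definition cube (n : nat) : finType := {ffun 'I_n -> bool}.

Definition cube_adj (n : nat) : rel (cube n) :=
  fun u v => #|[set i | u i != v i]%SET| == 1%N.

(* Main.v *)
Require Import Defs.
From mathcomp Require Import ring lra zify measurable_realfun.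

(** (i) holds without exception, as the cube is vertex-transitive, and (iii) is a
    Chernoff bound for the binomial distribution.

    (iv) A lazy step amounts to replacing a uniformly chosen coordinate by a fair
    bit.  Hence the law after t steps is a mixture, over the set A of coordinates
    drawn so far, of uniform laws on subcubes.  It follows that every transition
    probability from y to x is at most 2^-|x - y|, whatever t, and that the
    distance to equilibrium is at most the mean number n (1 - 1/n)^t of undrawn
    coordinates, so that the mixing time is at most n^2 + 2n.  A union bound over
    times then gives (iv) with L_N = n.

    (ii) As the cube is regular, the mass outside the J heaviest vertices is the
    sum of all but the J largest weights divided by the total weight.  For
    thresholds c and b it is at most #{j : W_j > c} / J + 1{all W_j <= b} +
    b^-1 sum_j W_j 1{W_j <= c}.  With f k = P(W > 2^k), slow variation says that
    f (k+1) / f k tends to 2^-alpha, strictly between 1/2 and 1.  So f decays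
    geometrically, whereas the truncated mean at 2^k is O(2^k f k).  Choosing b
    and c at a bounded number of octaves below the scale 2^k where N f k is of
    order 1 makes the last two terms small, and J to infinity the first one. *)

Local Open Scope ring_scope.

(** * The geometry of the hypercube *)

Definition hdist (n : nat) (u v : cube n) : nat := #|[set i | u i != v i]%SET|.

Definition flip (n : nat) (i : 'I_n) (u : cube n) : cube n :=
  [ffun j => u j (+) (j == i)].

(** Addition in the group (Z/2)^n, which acts transitively on the vertices by automorphisms of the
    cube. *)
Definition translate (n : nat) (c u : cube n) : cube n := [ffun i => c i (+) u i].

Section CubeMetric.
Variable n : nat.
Implicit Types u v w c : cube n.

Lemma card_cube : #|cube n| = (2 ^ n)%N.
Proof. by rewrite card_ffun card_bool card_ord. Qed.

Lemma cube_adjE u v : cube_adj u v = (hdist u v == 1%N).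
Proof. by []. Qed.

Lemma hdistC u v : hdist u v = hdist v u.
Proof. by apply: eq_card => i; rewrite !inE eq_sym. Qed.

Lemma hdist_eq0 u v : (hdist u v == 0%N) = (u == v).
Proof.
rewrite cards_eq0; apply/eqP/eqP => [/setP h|->]; last first.
  by apply/setP => i; rewrite !inE eqxx.
by apply/ffunP => i; have := h i; rewrite !inE => /negbFE/eqP.
Qed.

Lemma hdist_triangle v u w : (hdist u w <= hdist u v + hdist v w)%N.
Proof.
apply: leq_trans (leq_card_setU _ _); apply: subset_leq_card.
by apply/fintype.subsetP => i; rewrite !inE; case: (u i) (v i) (w i) => [] [] [].
Qed.

Lemma hdist_translate c u v : hdist (translate c u) (translate c v) = hdist u v.
Proof. by apply: eq_card => i; rewrite !inE !ffunE (inj_eq (@addbI _)). Qed.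

Lemma translateK c : involutive (translate c).
Proof. by move=> u; apply/ffunP => j; rewrite !ffunE addbA addbb addFb. Qed.

Lemma cube_adjP u v : reflect (exists i, v = flip i u) (cube_adj u v).
Proof.
apply: (iffP cards1P) => [[i /setP h]|[i ->]]; exists i.
  apply/ffunP => j; rewrite ffunE; have := h j; rewrite !inE => <-.
  by case: (u j) (v j) => [] [].
by apply/setP => j; rewrite !inE ffunE; case: (u j) (j == i) => [] [].
Qed.

Lemma cube_adjC : symmetric (@cube_adj n).
Proof. by move=> u v; rewrite !cube_adjE hdistC. Qed.

Lemma flip_inj u : injective (fun i : 'I_n => flip i u).
Proof.
by move=> i j /ffunP/(_ i); rewrite !ffunE eqxx => /addbI /esym/eqP.
Qed.

Lemma sum_cube_adj (T : nmodType) u (F : cube n -> T) :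
  \sum_(v | cube_adj u v) F v = \sum_i F (flip i u).
Proof.
rewrite -(big_imset _ (in2W (@flip_inj u)))/=.
apply: eq_bigl => v; apply/cube_adjP/imsetP.
  by move=> [i ->]; exists i.
by move=> [i _ ->]; exists i.
Qed.

Lemma deg_cube u : deg (@cube_adj n) u = n.
Proof.
rewrite /deg -sum1_card (eq_bigl (cube_adj u)); last by move=> v; rewrite inE.
by rewrite sum_cube_adj sum1_card card_ord.
Qed.

Lemma hdist_path u (p : seq (cube n)) :
  path (@cube_adj n) u p -> (hdist u (last u p) <= size p)%N.
Proof.
elim: p u => [u _|v p IH u /= /andP[/eqP uv /IH]].
  by rewrite leqn0 hdist_eq0.
move=> h; apply: leq_trans (hdist_triangle v _ _) _.
by rewrite {1}/hdist uv add1n ltnS.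
Qed.

Lemma hdist_flip u v i : u i != v i -> (hdist u v = (hdist (flip i u) v).+1)%N.
Proof.
move=> uvi; rewrite /hdist (cardsD1 i) inE uvi add1n; congr S.
apply: eq_card => j; rewrite !inE ffunE.
by have [->|/=] := eqVneq j i; [case: (u i) (v i) uvi => [] []|rewrite addbF].
Qed.

(** Induction on the Hamming distance: flipping a coordinate where [u] and [v] differ is a step
    along an edge that lowers the distance by one. *)
Lemma geodesic u v : exists p : seq (cube n),
  [/\ path (@cube_adj n) u p, last u p = v & size p = hdist u v].
Proof.
move: {2}(hdist u v) (erefl (hdist u v)) => k.
elim: k u => [|k IH] u uv.
  by exists [::]; split => //=; apply/eqP; rewrite -hdist_eq0 uv.
have /card_gt0P[i] : (0 < #|[set i | u i != v i]%SET|)%N by rewrite [#|_|]uv.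
rewrite inE => uvi; have /IH[p [up pv sp]] : hdist (flip i u) v = k.
  by apply/eq_add_S; rewrite -hdist_flip.
exists (flip i u :: p); split => //=; last by rewrite sp -hdist_flip.
by rewrite up andbT; apply/cube_adjP; exists i.
Qed.

Lemma gdist_cube (R : realType) u v :
  gdist (@cube_adj n) u v = (hdist u v)%:R%:E :> \bar R.
Proof.
apply/eqP; rewrite eq_le; apply/andP; split.
  have [p [up pv sp]] := geodesic u v.
  by apply: ereal_inf_lbound; exists p => //; rewrite sp.
apply/ereal_infP => _ [p [up <-] <-].
by rewrite lee_fin ler_nat; exact: hdist_path.
Qed.

Lemma in_gball_cube (R : realType) u v (r : R) :
  (v \in gball (@cube_adj n) u r) = ((hdist u v)%:R <= r).
Proof. by rewrite inE gdist_cube lee_fin. Qed.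

Lemma cube_rooted_equiv (R : realType) u v (r : R) :
  rooted_equiv (@cube_adj n) u (gball (@cube_adj n) u r)
                             v (gball (@cube_adj n) v r).
Proof.
(* Translation by [u + v] sends [u] to [v]; being an isometry, it carries the ball about [u] onto
   the ball about [v]. *)
pose c := translate u v; exists (translate c).
have cu : translate c u = v.
  by apply/ffunP => i; rewrite !ffunE addbAC addbb addFb.
split => //.
- by move=> a b _ _ /(can_inj (translateK c)).
- apply/setP => w; rewrite -{1}(translateK c w) (mem_imset _ _ (can_inj (translateK c))).
  by rewrite !in_gball_cube -(hdist_translate c) translateK cu.
- by move=> a b _ _; rewrite !cube_adjE hdist_translate.
Qed.

(** The sum factors over the coordinates, each contributing 1 for agreement with [u] and [s] for
    disagreement. *)
Lemma sum_expr_hdist (R : comNzRingType) (s : R) u :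
  \sum_v s ^+ hdist u v = (1 + s) ^+ n.
Proof.
have -> : (1 + s) ^+ n = \prod_(i < n) \sum_(b : bool) (if u i != b then s else 1).
  rewrite (eq_bigr (fun=> 1 + s)) ?prodr_const ?card_ord// => i _.
  by rewrite big_bool/=; case: (u i) => //=; rewrite addrC.
rewrite bigA_distr_bigA/=; apply: eq_bigr => v _.
rewrite -big_mkcond/= -prodr_const; apply: eq_bigl => i; by rewrite inE.
Qed.

(* Chernoff: the weight (3/4)^(5d) is at least (3/4)^n on the ball. *)
Lemma card_gball_cube (R : realType) u :
  #|gball (@cube_adj n) u (2 * (n%:R / 10) : R)|%:R / #|cube n|%:R <=
    (5 / 6 : R) ^+ n.
Proof.
set B := gball _ _ _.
have h : #|B|%:R * (3 / 4) ^+ n <= (1 + (3 / 4) ^+ 5 : R) ^+ n.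
  rewrite -(sum_expr_hdist _ u) -sum1_card natr_sum mulr_suml.
  rewrite [leRHS](bigID (mem B))/= -[leLHS]addr0; apply: lerD; last first.
    by apply: sumr_ge0 => v _; apply: exprn_ge0; apply: exprn_ge0; lra.
  apply: ler_sum => v; rewrite in_gball_cube mul1r -exprM => uv.
  apply: ler_wiXn2l; [lra|lra|].
  by rewrite -(ler_nat R) natrM; lra.
rewrite card_cube ler_pdivrMr ?ltr0n ?expn_gt0// natrX -exprMn.
rewrite -(ler_pM2r (exprn_gt0 n (_ : 0 < 3 / 4 :> R))); last lra.
(* It remains to compare the bases: 1 + (3/4)^5 is below 5/4, which is 5/6 times 2 times 3/4. *)
apply: le_trans h _; rewrite -exprMn; apply: lerXn2r; rewrite ?nnegrE; lra.
Qed.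

End CubeMetric.

(** * Mixing of the lazy walk *)

Lemma bernoulli (R : realDomainType) (v : R) (k : nat) :
  0 <= v -> 1 + k%:R * v <= (1 + v) ^+ k.
Proof.
move=> v0; elim: k => [|k IH]; first by rewrite mul0r addr0 expr0.
rewrite exprS -natr1; have k0 : 0 <= k%:R :> R by [].
have : (1 + v) * (1 + k%:R * v) <= (1 + v) * (1 + v) ^+ k.
  by apply: ler_wpM2l => //; lra.
by apply: le_trans; have := mulr_ge0 k0 (sqr_ge0 v); lra.
Qed.

(* [refresh_mean t F] is the mean of F at the set of coordinates drawn in t
   uniform draws with replacement. *)
Fixpoint refresh_mean (R : realType) (n t : nat) (F : {set 'I_n} -> R) : R :=
  if t is t'.+1
  then refresh_mean t' (fun A => n%:R^-1 * \sum_i F (i |: A)%SET) else F finset.set0.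

(* The probability of y when the coordinates of x in A are replaced by
   independent fair bits. *)
Definition refreshed (R : realType) (n : nat) (x : cube n) (A : {set 'I_n})
    (y : cube n) : R :=
  \prod_i (if i \in A then 1 / 2 else (x i == y i)%:R).

(** * Averages over the set of drawn coordinates *)

Section RefreshMean.
Variables (R : realType) (n : nat).
Implicit Types (t : nat) (F G : {set 'I_n} -> R) (x y : cube n).

Lemma refresh_mean_le t F G :
  (forall A, F A <= G A) -> refresh_mean t F <= refresh_mean t G.
Proof.
elim: t F G => [|t IH] F G FG //=; apply: IH => A.
by apply: ler_wpM2l; rewrite ?invr_ge0// ler_sum.
Qed.

Lemma refresh_mean0 t : refresh_mean t (fun _ : {set 'I_n} => 0 : R) = 0.
Proof.
elim: t => [//|t {2}<- /=]; congr refresh_mean; apply/funext => A.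
by rewrite big1 ?mulr0.
Qed.

Lemma refresh_meanD t F G :
  refresh_mean t (F \+ G) = refresh_mean t F + refresh_mean t G.
Proof.
elim: t F G => [|t IH] F G //=; rewrite -IH; congr refresh_mean.
by apply/funext => A /=; rewrite big_split mulrDr.
Qed.

Lemma refresh_meanZ t a F : refresh_mean t (fun A => a * F A) = a * refresh_mean t F.
Proof.
elim: t F => [|t IH] F //=; rewrite -IH; congr refresh_mean.
by apply/funext => A /=; rewrite -mulr_sumr mulrCA.
Qed.

Lemma refresh_mean_sum t (I : Type) (r : seq I) (P : pred I)
    (F : I -> {set 'I_n} -> R) :
  refresh_mean t (fun A => \sum_(i <- r | P i) F i A) =
  \sum_(i <- r | P i) refresh_mean t (F i).
Proof.
elim: r => [|i r IH].
  rewrite big_nil -[RHS](refresh_mean0 t).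
  by congr refresh_mean; apply/funext => A; rewrite big_nil.
rewrite big_cons -IH; case: ifP => Pi; rewrite -?refresh_meanD;
  by congr refresh_mean; apply/funext => A; rewrite big_cons Pi.
Qed.

Lemma refresh_mean_cst t (a : R) : (0 < n)%N -> refresh_mean t (fun _ : {set 'I_n} => a) = a.
Proof.
move=> n0; elim: t => [//|t {2}<- /=]; congr refresh_mean; apply/funext => A.
by rewrite sumr_const card_ord -[a *+ n]mulr_natl mulKf// pnatr_eq0 -lt0n.
Qed.

(** Each draw leaves a given undrawn coordinate undrawn with probability 1 - 1/n, so one averaging
    step multiplies [#|~: A|] by that factor. *)
Lemma refresh_mean_card t : (0 < n)%N ->
  refresh_mean t (fun A : {set 'I_n} => #|~: A|%:R : R) = n%:R * (1 - n%:R^-1) ^+ t.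
Proof.
move=> n0; have n0' : n%:R != 0 :> R by rewrite pnatr_eq0 -lt0n.
elim: t => [|t IH]; first by rewrite /= expr0 mulr1 finset.setC0 cardsT card_ord.
rewrite exprSr mulrA -IH mulrC -refresh_meanZ /=.
congr refresh_mean; apply/funext => A.
have -> : \sum_i #|~: (i |: A)|%:R = n%:R * #|~: A|%:R - #|~: A|%:R :> R.
  have {2}-> : #|~: A|%:R = \sum_i (i \in ~: A)%:R :> R.
    by rewrite -sum1_card natr_sum big_mkcond; apply: eq_bigr => i _; case: ifP.
  apply/eqP; rewrite eq_sym subr_eq eq_sym -big_split/=; apply/eqP.
  rewrite (eq_bigr (fun=> #|~: A|%:R)).
    by rewrite sumr_const card_ord mulr_natl.
  move=> i _; rewrite -natrD addnC [in RHS](cardsD1 i); congr (_ + _)%:R.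
  by apply: eq_card => j; rewrite !inE negb_or.
by field.
Qed.

End RefreshMean.

(** * The lazy walk as a mixture of uniform laws on subcubes *)

Section Refreshed.
Variables (R : realType) (n : nat).
Implicit Types (t : nat) (A : {set 'I_n}) (x y : cube n).

Lemma refreshed_ge0 x A y : 0 <= refreshed R x A y.
Proof. by apply: prodr_ge0 => i _; case: ifP; rewrite ?divr_ge0. Qed.

(** Factor by factor: where [x] and [y] differ the factor is 1/2 or 0, elsewhere it is at most 1. *)
Lemma refreshed_le x A y : refreshed R x A y <= (1 / 2) ^+ hdist x y.
Proof.
rewrite /hdist -prodr_const [leRHS]big_mkcond/=; apply: ler_prod => i _.
by rewrite inE; case: (i \in A); case: (x i == y i) => /=; lra.
Qed.

Lemma sum_refreshed x A : \sum_y refreshed R x A y = 1.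
Proof.
rewrite /refreshed -(bigA_distr_bigA
  (fun i b => if i \in A then 1 / 2 else (x i == b)%:R : R))/=.
rewrite big1// => i _; rewrite big_bool/=.
by case: (i \in A); case: (x i) => /=; lra.
Qed.

Lemma refreshed_set0 x y : refreshed R x finset.set0 y = (x == y)%:R.
Proof.
rewrite /refreshed; have [->|] := eqVneq x y.
  by rewrite big1// => i _; rewrite inE eqxx.
rewrite -hdist_eq0 -lt0n => /card_gt0P[i]; rewrite inE => /negPf xyi.
by rewrite (bigD1 i)//= inE xyi mul0r.
Qed.

Lemma refreshed_setT x y : refreshed R x [set: 'I_n]%SET y = (1 / 2) ^+ n.
Proof.
rewrite /refreshed (eq_bigr (fun=> 1 / 2)) ?prodr_const ?card_ord// => i _.
by rewrite inE.
Qed.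

(** Only the factor at [i] changes, and averaging over both values of [y i] makes it 1/2 whether or
    not [i] is in [A]. Thus keeping or flipping [i] with equal probability refreshes it. *)
Lemma refreshed_flip x A y (i : 'I_n) :
  (refreshed R x A y + refreshed R x A (flip i y)) / 2 = refreshed R x (i |: A) y.
Proof.
have D B z : refreshed R x B z = (if i \in B then 1 / 2 else (x i == z i)%:R) *
    \prod_(j | j != i) (if j \in B then 1 / 2 else (x j == z j)%:R).
  exact: bigD1.
rewrite !D !inE eqxx/= ffunE eqxx addbT.
set p := (X in _ * X + _); have -> : \prod_(j | j != i)
    (if j \in A then 1 / 2 else (x j == flip i y j)%:R) = p.
  by apply: eq_bigr => j ji; rewrite ffunE (negPf ji) addbF.
have -> : \prod_(j | j != i)
    (if j \in (i |: A)%SET then 1 / 2 else (x j == y j)%:R) = p.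
  by apply: eq_bigr => j ji; rewrite !inE (negPf ji).
by move: p => p; case: (i \in A); case: (x i) (y i) => [] [] /=; field.
Qed.

Hypothesis n_gt0 : (0 < n)%N.

Let n_neq0 : n%:R != 0 :> R.
Proof. by rewrite pnatr_eq0 -lt0n. Qed.

Lemma lazy_law_refreshed x t y :
  lazy_law (@cube_adj n) x t y = refresh_mean t (fun A => refreshed R x A y).
Proof.
elim: t y => [|t IH] y /=; first by rewrite refreshed_set0.
(* A lazy step picks [i] uniformly and then stays or flips [i] with probability 1/2 each; the
   predecessors of [y] other than [y] are its flips. *)
have -> : \sum_z lazy_law (@cube_adj n) x t z * lazy_step (@cube_adj n) z y =
    n%:R^-1 * \sum_i ((refresh_mean t (fun A => refreshed R x A y) +
                       refresh_mean t (fun A => refreshed R x A (flip i y))) / 2).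
  rewrite /lazy_step; under eq_bigr do rewrite deg_cube mulrDr cube_adjC.
  rewrite big_split/= (bigD1 y)//= eqxx big1 ?addr0; last first.
    by move=> z /negPf ->; rewrite mul0r mulr0.
  rewrite -mulr_suml big_split/= sumr_const card_ord -[refresh_mean _ _ *+ n]mulr_natl.
  rewrite (eq_bigr (fun z => if cube_adj y z then
     lazy_law (@cube_adj n) x t z / (2 * n%:R) else 0)); last first.
    by move=> z _; case: ifP => _; rewrite ?mul0r ?mulr0// mul1r.
  rewrite -big_mkcond/= sum_cube_adj -mulr_suml (funext IH).
  by field.
have -> : (fun A => n%:R^-1 * \sum_i refreshed R x (i |: A)%SET y) =
    (fun A => n%:R^-1 * \sum_i
       (2^-1 * (refreshed R x A y + refreshed R x A (flip i y)))).
  apply/funext => A; congr (_ * _); apply: eq_bigr => i _.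
  by rewrite -refreshed_flip mulrC.
rewrite refresh_meanZ refresh_mean_sum; congr (_ * _); apply: eq_bigr => i _.
by rewrite refresh_meanZ mulrC; congr (_ * _); rewrite -refresh_meanD.
Qed.

Lemma lazy_law_le x t y : lazy_law (@cube_adj n) x t y <= (1 / 2 : R) ^+ hdist x y.
Proof.
rewrite lazy_law_refreshed -[leRHS](refresh_mean_cst t _ n_gt0).
by apply: refresh_mean_le => A; exact: refreshed_le.
Qed.

Lemma stationary_cube y : stationary (@cube_adj n) y = (1 / 2 : R) ^+ n.
Proof.
rewrite /stationary; under eq_bigr do rewrite deg_cube.
rewrite deg_cube sum_nat_const card_cube natrM natrX expr_div_n expr1n.
by field; rewrite n_neq0 expf_neq0// pnatr_eq0.
Qed.

(** Once all coordinates are drawn the law is exactly uniform. For any other [A] the two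
    probabilities of [B] differ by at most 1, hence by at most the number of undrawn coordinates. *)
Lemma tv_dist_cube_le x t :
  tv_dist (lazy_law (@cube_adj n) x t) (stationary (@cube_adj n)) <=
    n%:R * (1 - n%:R^-1) ^+ t :> R.
Proof.
rewrite -refresh_mean_card//; apply: bigmax_le => [|B _].
  by rewrite -(refresh_mean0 R n t); apply: refresh_mean_le.
have part A : 0 <= \sum_(y in B) refreshed R x A y <= 1.
  rewrite sumr_ge0 => [|y _]; last exact: refreshed_ge0.
  rewrite -(sum_refreshed x A) [leRHS](bigID (mem B))/= lerDl.
  by apply: sumr_ge0 => y _; exact: refreshed_ge0.
have dist A : `|\sum_(y in B) refreshed R x A y -
                \sum_(y in B) refreshed R x [set: 'I_n]%SET y| <= #|~: A|%:R.
  have [->|] := eqVneq A [set: 'I_n]%SET; first by rewrite subrr normr0.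
  rewrite -(inj_eq (can_inj (@finset.setCK _))) finset.setCT -card_gt0 => cA.
  apply: (@le_trans _ _ 1); last by rewrite ler1n.
  have /andP[h1 h2] := part A; have /andP[h3 h4] := part [set: 'I_n]%SET.
  by rewrite ler_norml; apply/andP; split; lra.
(* The stationary law is the refreshed law for the full set, a constant under the mean, so the
   difference is itself a mean. *)
have -> : \sum_(y in B) lazy_law (@cube_adj n) x t y -
          \sum_(y in B) stationary (@cube_adj n) y =
    refresh_mean t (fun A => \sum_(y in B) refreshed R x A y -
                             \sum_(y in B) refreshed R x [set: 'I_n]%SET y).
  under [X in X - _]eq_bigr do rewrite lazy_law_refreshed.
  rewrite -refresh_mean_sum.
  have <- : \sum_(y in B) refreshed R x [set: 'I_n]%SET y =
            \sum_(y in B) stationary (@cube_adj n) y.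
    by apply: eq_bigr => y _; rewrite refreshed_setT stationary_cube.
  by rewrite -[X in _ - X](refresh_mean_cst t _ n_gt0) -mulN1r -refresh_meanZ
    -refresh_meanD; congr refresh_mean; apply/funext => A /=; rewrite mulN1r.
rewrite ler_norml; apply/andP; split.
  rewrite -mulN1r -refresh_meanZ; apply: refresh_mean_le => A.
  by rewrite mulN1r; have := dist A; rewrite ler_norml => /andP[].
apply: refresh_mean_le => A.
by have := dist A; rewrite ler_norml => /andP[].
Qed.

Lemma mixing_time_cube_le :
  (mixing_time (@cube_adj n) <= (n ^ 2 + 2 * n)%:R%:E :> \bar R)%E.
Proof.
apply: ereal_inf_lbound; exists (n ^ 2 + 2 * n)%N => //=.
apply: bigmax_le => [|y _]; first by lra.
apply: le_trans (tv_dist_cube_le _ _) _.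
have n1 : 1 <= n%:R :> R by rewrite ler1n.
have v1 : n%:R^-1 <= 1 :> R by rewrite invf_le1// ltr0n.
have v0 : 0 < n%:R^-1 :> R by rewrite invr_gt0 ltr0n.
(* Bernoulli gives (1 + 1/n)^n >= 2, and (1 - 1/n)(1 + 1/n) <= 1. *)
have half : (1 - n%:R^-1) ^+ n <= 1 / 2 :> R.
  have h := bernoulli n (ltW v0).
  rewrite divff// in h.
  have : (1 - n%:R^-1) ^+ n * (1 + n%:R^-1 : R) ^+ n <= 1.
    rewrite -exprMn; apply: exprn_ile1; nra.
  have : 0 <= (1 - n%:R^-1 : R) ^+ n by apply: exprn_ge0; lra.
  move: h; move: (_ ^+ n) (_ ^+ n) => X Y; nra.
(* The time is n(n + 2), so the bound becomes n 2^-(n+2), which is at most 1/4 because n < 2^n. *)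
rewrite -mulnn -mulnDl mulnC exprM.
have h : ((1 - n%:R^-1) ^+ n) ^+ (n + 2) <= (1 / 2) ^+ (n + 2) :> R.
  by apply: lerXn2r => //; rewrite nnegrE ?exprn_ge0//; lra.
apply: le_trans (ler_wpM2l _ h) _ => //.
rewrite expr_div_n expr1n addn2 -natrX mulrA mulr1 ler_pdivrMr ?ltr0n ?expn_gt0//.
rewrite mul1r mulrC ler_pdivlMr// -natrM ler_nat !expnS.
have := ltn_expl n (ltnSn 1); lia.
Qed.
End Refreshed.

Local Open Scope classical_set_scope.
Local Open Scope ring_scope.

(** * Expectations and hitting probabilities *)

Import HBNNSimple.

Section Expectation.
Context {d : measure_display} {T : measurableType d} {R : realType}.
Variable P : probability T R.
Local Open Scope ereal_scope.

(* f need not be measurable: every simple function below f lies a.e. below g. *)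
Lemma ge0_integral_le_ae (f g : T -> \bar R) :
  (forall x, 0 <= f x) -> (forall x, 0 <= g x) -> measurable_fun [set: T] g ->
  {ae P, forall x, f x <= g x} -> \int[P]_x f x <= \int[P]_x g x.
Proof.
move=> f0 g0 mg fg; rewrite ge0_integralTE//.
apply: ge_ereal_sup => _ [h /= hf <-]; rewrite -integralT_nnsfun.
apply: ae_ge0_le_integral => //.
- by move=> x _; rewrite lee_fin fun_ge0.
- by apply/measurable_EFinP.
- by apply: filterS fg => x fg _; exact: le_trans (hf x) fg.
Qed.

(** The expectation is the integral of the positive part minus that of the negative part; the latter
    is zero almost everywhere, the former is dominated by [g]. *)
Lemma expectation_ae_bounds (f : T -> R) (g : T -> \bar R) :
  (forall x, 0 <= g x) -> measurable_fun [set: T] g ->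
  {ae P, forall x, (0 <= f x)%R /\ (f x)%:E <= g x} ->
  0 <= 'E_P[f] <= \int[P]_x g x.
Proof.
move=> g0 mg fg; rewrite unlock integralE.
have -> : \int[P]_x (EFin \o f)^\- x = 0.
  apply/eqP; rewrite eq_le integral_ge0// andbT -(integral0 P setT).
  apply: ge0_integral_le_ae => //.
  by apply: filterS fg => x [fx _]; rewrite funenegE ge_max lexx andbT leeNl oppe0 lee_fin.
rewrite sube0 integral_ge0//=; apply: ge0_integral_le_ae => //.
by apply: filterS fg => x [fx fgx]; rewrite funeposE ge_max fgx g0.
Qed.

Lemma expectation_bounds (f : T -> R) (c : R) :
  (forall x, 0 <= f x <= c)%R -> 0 <= 'E_P[f] <= c%:E.
Proof.
move=> fc; have -> : c%:E = \int[P]_x cst c%:E x.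
  by rewrite integral_cst//= [X in _ * X]probability_setT mule1.
apply: expectation_ae_bounds => //.
  by move=> x; rewrite lee_fin; have /andP[f0 f1] := fc x; exact: le_trans f1.
by apply: aeW => x; have /andP[? ?] := fc x; rewrite lee_fin.
Qed.

End Expectation.

(** * Marginal laws of a Markov chain *)

Section Markov.
Context {d : measure_display} {T : measurableType d} {R : realType}.
Variable P : probability T R.
Local Open Scope ereal_scope.

Lemma measure_partition (U : finType) (Z : T -> U) (B : set T) :
  (forall u, measurable (Z @^-1` [set u])) -> measurable B ->
  P B = \sum_u P (Z @^-1` [set u] `&` B).
Proof.
move=> mZ mB.
rewrite [RHS]fsbig_seq ?index_enum_uniq//= -measure_fin_bigcup//.
- congr (P _); apply/seteqP; split => [om Bom|om [u _ []]//].
  by exists (Z om) => //=; rewrite mem_index_enum.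
- by apply/trivIsetP => u v _ _ uv; apply/seteqP; split => // om [[/= uE _] [vE _]];
    move: uv; rewrite -uE -vE eqxx.
- by move=> u _; exact: measurableI.
Qed.

(** The definition prescribes the probabilities of whole paths; summing them over the past yields
    the one-step recursion that defines [lazy_law]. *)
Lemma is_markov_chain_law (V : finType) (e : rel V) (x : V) (S : nat -> T -> V)
    (k : nat) (y : V) :
  is_markov_chain P (lazy_step e) x S ->
  P (S k @^-1` [set y]) = (lazy_law e x k y)%:E.
Proof.
move=> [rS pS].
have mS j u : measurable (S j @^-1` [set u]) by exact: rS.
have step j u v : P (S j @^-1` [set u] `&` S j.+1 @^-1` [set v]) =
    P (S j @^-1` [set u]) * (lazy_step e u v)%:E.
  (* [Z] records the history strictly before time [j]. *)
  pose Z om : {ffun 'I_j -> V} := [ffun i : 'I_j => S i om].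
  have mZ z : measurable (Z @^-1` [set z]).
    have -> : Z @^-1` [set z] = \bigcap_(i in [set: 'I_j]) S i @^-1` [set z i].
      apply/seteqP; split => [om /= <- i _|om h]; first by rewrite ffunE.
      by apply/ffunP => i; rewrite ffunE; exact: h.
    by apply: fin_bigcap_measurable => //; exact: finite_finset.
  rewrite (measure_partition mZ) ?(measure_partition mZ (mS j u))//; last first.
    exact: measurableI.
  rewrite ge0_sume_distrl//; apply: eq_bigr => z _.
  (* The path following [z] before time [j], then visiting [u] at time [j] and [v] at time
     [j.+1]. *)
  pose w i := if insub i is Some i' then z i' else if i == j then u else v.
  have wz (i : 'I_j) : w i = z i by rewrite /w valK.
  have wj : w j = u by rewrite /w insubF ?ltnn ?eqxx.
  have wj1 : w j.+1 = v by rewrite /w insubF ?ltnNge ?leqnSn ?gtn_eqF.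
  have E1 : Z @^-1` [set z] `&` S j @^-1` [set u] =
      [set om | forall k, (k <= j)%N -> S k om = w k].
    apply/seteqP; split => [om [/= zE uE] i|om h].
      rewrite leq_eqVlt => /predU1P[->|ij]; first by rewrite wj.
      by rewrite (wz (Ordinal ij)) -zE ffunE.
    split => /=; last by rewrite h.
    by apply/ffunP => i; rewrite ffunE h// 1?ltnW.
  have E2 : Z @^-1` [set z] `&` (S j @^-1` [set u] `&` S j.+1 @^-1` [set v]) =
      [set om | forall k, (k <= j.+1)%N -> S k om = w k].
    rewrite setIA E1; apply/seteqP; split => [om [/= zE uE] i|om h].
      by rewrite leq_eqVlt => /predU1P[->|]; [rewrite wj1|exact: zE].
    split => /=; last by rewrite h.
    by move=> i ij; rewrite h// leqW.
  by rewrite E2 E1 !pS big_ord_recr/= mulrA wj wj1 EFinM.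
elim: k y => [|k IH] y.
  have -> : S 0%N @^-1` [set y] =
      [set om | forall k, (k <= 0)%N -> S k om = cst y k].
    apply/seteqP; split => [om /= h i|om h]; last exact: h.
    by rewrite leqn0 => /eqP ->.
  by rewrite pS big_ord0 mulr1.
rewrite (measure_partition (mS k))//= -sumEFin; apply: eq_bigr => u _.
by rewrite step IH.
Qed.

End Markov.

(** * Hitting probabilities by a union bound over times *)

Section Hitting.
Context {d : measure_display} {T : measurableType d} {R : realType}.
Variable P : probability T R.

(** A finite infimum of times is attained at the first visit. At [c = +oo] the equivalence would
    fail on paths that never visit [x]. *)
Lemma hitting_time_leP (V : eqType) (S : nat -> T -> V) (x : V) om (c : \bar R) :
  (c < +oo)%E -> (hitting_time S x om <= c)%E <->
  exists2 k, (k%:R%:E <= c)%E & S k om = x.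
Proof.
move=> coo; split=> [hc|[k kc Skx]]; last first.
  by apply: le_trans kc; apply: ereal_inf_lbound; exists k.
have [_ [k /= Skx _] _] := ereal_inf_lt (le_lt_trans hc coo).
have ex : exists k, S k om == x by exists k; apply/eqP.
case: (ex_minnP ex) => m /eqP Smx mmin; exists m => //.
apply: le_trans hc; apply/ereal_infP => _ [j /= Sjx <-].
by rewrite lee_fin ler_nat; apply: mmin; apply/eqP.
Qed.

Lemma hitting_time_bound (V : finType) (e : rel V) (S : nat -> T -> V) (x y : V)
    (c : \bar R) (m : nat) (a : R) :
  is_markov_chain P (lazy_step e) y S -> (c < m%:R%:E)%E ->
  (forall k, lazy_law e y k x <= a) ->
  (P [set om | (hitting_time S x om <= c)%E] <= (m%:R * a)%:E)%E.
Proof.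
move=> SP cm ea; have [mS _] := SP.
have mSx k : measurable (S k @^-1` [set x]) by exact: mS.
have mU : measurable (\big[setU/set0]_(k < m) S k @^-1` [set x]).
  exact: bigsetU_measurable.
apply: (@le_trans _ _ (P (\big[setU/set0]_(k < m) S k @^-1` [set x]))).
  (* As a countable union of visits the event is measurable, and only times below [m] occur in
     it. *)
  have -> : [set om | (hitting_time S x om <= c)%E] =
      \bigcup_(k in [set k | (k%:R%:E <= c)%E]) S k @^-1` [set x].
    apply/seteqP; split => [om|om [k kc Skx]] /=.
      by move/(hitting_time_leP _ _ _ (lt_trans cm (ltry _))) => [k kc Skx]; exists k.
    by apply/(hitting_time_leP _ _ _ (lt_trans cm (ltry _))); exists k.
  apply: le_measure; rewrite ?inE//.
    by apply: bigcup_measurable => k _.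
  rewrite -(bigcup_mkord m (fun k => S k @^-1` [set x])) => om [k /= kc Skx]; exists k => //=.
  by rewrite -(ltr_nat R) -lte_fin; exact: le_lt_trans cm.
apply: le_trans (@Boole_inequality _ _ _ P (fun k => S k @^-1` [set x]) m _) _ => //.
rewrite mulr_natl -[m in leRHS]card_ord -sumr_const -sumEFin.
by apply: lee_sum => k _; rewrite [leLHS](is_markov_chain_law _ _ SP) lee_fin.
Qed.

End Hitting.

Lemma cvg_expectation_squeeze (R : realType) (d : nat -> measure_display)
    (Om : forall n, measurableType (d n)) (P : forall n, probability (Om n) R)
    (f : forall n, Om n -> R) (u : nat -> R) :
  (forall n om, (0 < n)%N -> 0 <= f n om <= u n) -> u n @[n --> \oo] --> 0 ->
  ('E_(P n)[f n])%E @[n --> \oo] --> 0%E.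
Proof.
move=> fu u0; apply: (@squeeze_cvge _ _ _ _ (fun=> 0%E) _ (EFin \o u)).
- near=> n; apply: expectation_bounds => om; apply: fu.
  by near: n; exact: nbhs_infty_gt.
- exact: cvg_cst.
- by apply: cvg_EFin u0; near=> n.
Unshelve. all: by end_near. Qed.

(** The horizon is cubic in n, while from distance above n/10 each single time contributes at most
    2^(-n/10); the exponential wins. *)
Lemma cube_hitting_max_le (R : realType) (n : nat) (d : measure_display)
    (Om : measurableType d) (Q : cube n -> probability Om R)
    (S : nat -> Om -> cube n) (x : cube n) :
  (0 < n)%N ->
  (forall y, is_markov_chain (Q y) (lazy_step (@cube_adj n)) y S) ->
  0 <= \big[Num.max/0]_(y | y \notin gball (@cube_adj n) x (n%:R / 10 : R))
     fine (Q y [set om | (hitting_time S x om <=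
       (n%:R : R)%:E * mixing_time (@cube_adj n))%E])
    <= 4 * 100 ^+ 3 * (99 / 100) ^+ n.
Proof.
move=> n0 SQ; rewrite bigmax_ge_id/=.
apply: bigmax_le => [|y]; first by apply: mulr_ge0; [lra|apply: exprn_ge0; lra].
rewrite in_gball_cube -ltNge hdistC => xy.
(* The final 1 in [m] makes the horizon strictly smaller than [m]. *)
set c := (_ * mixing_time _)%E; pose m := (n ^ 3 + 2 * n ^ 2 + 1)%N.
have cm : (c < m%:R%:E)%E.
  apply: (@le_lt_trans _ _ (n%:R%:E * (n ^ 2 + 2 * n)%:R%:E)%E).
    by apply: lee_wpmul2l; [rewrite lee_fin|exact: mixing_time_cube_le].
  rewrite -EFinM -natrM lte_fin ltr_nat /m; lia.
(* Here 1/2 <= (19/20)^10 replaces the root 2^(-1/10) by a rational base. *)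
have law k : lazy_law (@cube_adj n) y k x <= (19 / 20 : R) ^+ n.
  apply: le_trans (lazy_law_le R n0 _ _ _) _.
  have h : (n <= 10 * hdist y x)%N.
    by rewrite -(ler_nat R) natrM; lra.
  apply: (@le_trans _ _ ((19 / 20) ^+ (10 * hdist y x))); last first.
    by apply: ler_wiXn2l => //; lra.
  by rewrite exprM; apply: lerXn2r; rewrite ?nnegrE; lra.
have := hitting_time_bound (SQ y) cm law.
move=> h; have : fine (Q y [set om | (hitting_time S x om <= c)%E]) <=
    m%:R * (19 / 20) ^+ n.
  by have := fine_le _ _ h; apply => //; rewrite ?ge0_fin_numE// (le_lt_trans h)// ltry.
move/le_trans; apply.
have m4 : (m <= 4 * n ^ 3)%N by rewrite /m; nia.
apply: (@le_trans _ _ (4 * n%:R ^+ 3 * (19 / 20) ^+ n)).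
  apply: ler_wpM2r; first by apply: exprn_ge0; lra.
  by rewrite -natrX -natrM ler_nat.
(* The base 101/100 absorbs the cubic factor, since (101/100)^3 times 19/20 is still below
   99/100. *)
have n1 : n%:R <= 100 * (101 / 100) ^+ n :> R.
  have -> : 101 / 100 = 1 + 1 / 100 :> R by lra.
  have := @bernoulli R (1 / 100) n; move: (_ ^+ n) => X; lra.
have n3 : n%:R ^+ 3 <= 100 ^+ 3 * ((101 / 100) ^+ 3) ^+ n :> R.
  by rewrite exprAC -exprMn; apply: lerXn2r; rewrite ?nnegrE.
apply: (@le_trans _ _ (4 * (100 ^+ 3 * ((101 / 100) ^+ 3) ^+ n) * (19 / 20) ^+ n)).
  apply: ler_wpM2r; first by apply: exprn_ge0; lra.
  by apply: ler_wpM2l => //; lra.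
rewrite -!mulrA -exprMn; do 4!(apply: ler_wpM2l; first lra).
by apply: lerXn2r; rewrite ?nnegrE; lra.
Qed.

(** * Concentration of heavy-tailed weights *)

(** The ratio is at most 1, which settles the cases where at least [J] entries exceed [c] or no
    entry exceeds [b]. Otherwise the total is at least [b], and every dropped entry is at most [c],
    hence dominated by [g]. *)
Lemma tail_ratio_le (R : realType) (s : seq R) (J : nat) (b c : R) (g : R -> R) :
  sorted >=%O s -> all (> 0) s -> (0 < J)%N -> 0 < b ->
  (forall t, 0 <= g t) -> (forall t, t <= c -> t <= g t) ->
  (\sum_(t <- drop J s) t) / (\sum_(t <- s) t) <=
    (count (> c) s)%:R / J%:R + (all (<= b) s)%:R + (\sum_(t <- s) g t) / b.
Proof.
move=> ss s0 J0 b0 g0 gc.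
have sT0 : 0 <= \sum_(t <- s) t.
  by rewrite big_seq; apply: sumr_ge0 => t /(allP s0)/ltW.
have split (F : R -> R) : \sum_(t <- s) F t =
    \sum_(t <- take J s) F t + \sum_(t <- drop J s) F t.
  by rewrite -big_cat cat_take_drop.
have le1 : (\sum_(t <- drop J s) t) / (\sum_(t <- s) t) <= 1.
  have [<-|sTn0] := eqVneq 0 (\sum_(t <- s) t); first by rewrite invr0 mulr0.
  rewrite ler_pdivrMr ?mul1r; last by rewrite lt_def eq_sym sTn0.
  rewrite split lerDr big_seq; apply: sumr_ge0 => t /mem_take/(allP s0)/ltW//.
have t1 : 0 <= (count (> c) s)%:R / J%:R :> R by rewrite divr_ge0.
have t3 : 0 <= (\sum_(t <- s) g t) / b by rewrite divr_ge0 ?sumr_ge0// ltW.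
have [cJ|cJ] := leqP J (count (> c) s).
  apply: le_trans le1 _; have : 1 <= (count (> c) s)%:R / J%:R :> R.
    by rewrite ler_pdivlMr ?ltr0n// mul1r ler_nat.
  have : 0 <= (all (<= b) s)%:R :> R by [].
  by lra.
have [_|] := boolP (all (<= b) s).
  by apply: le_trans le1 _; rewrite (_ : true%:R = 1)//; lra.
rewrite -has_predC => /hasP[u us /=]; rewrite -ltNge => bu.
(* If a dropped entry exceeded [c], so would the [J] entries sorted before it, against the case
   assumption. *)
have dc t : t \in drop J s -> t <= c.
  move=> tJ; rewrite leNgt; apply/negP => ct; move: cJ; apply/negP; rewrite -leqNgt.
  have sJ : size (take J s) = J.
    rewrite size_takel// leqNgt; apply/negP => /ltnW sJ.
    by rewrite drop_oversize in tJ.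
  rewrite -[s in count _ s](cat_take_drop J) count_cat -[J in (J <= _)%N]sJ.
  suff : all (> c) (take J s) by rewrite all_count => /eqP ->; exact: leq_addr.
  apply/allP => v vJ /=.
  apply: lt_le_trans ct _; move: ss.
  rewrite (sorted_pairwise ge_trans) -(cat_take_drop J s) pairwise_cat.
  by move=> /and3P[/allrelP/(_ v t vJ tJ)].
have ub : b <= \sum_(t <- s) t.
  apply: le_trans (ltW bu) _; rewrite (big_rem u us)/= lerDl big_seq.
  by apply: sumr_ge0 => t /mem_rem/(allP s0)/ltW.
have dg : \sum_(t <- drop J s) t <= \sum_(t <- s) g t.
  rewrite split -[leLHS]add0r lerD//; first exact: sumr_ge0.
  by rewrite big_seq [leRHS]big_seq; apply: ler_sum => t /dc /gc.
apply: (@le_trans _ _ ((\sum_(t <- s) g t) / b)); last by rewrite (_ : false%:R = 0)//; lra.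
apply: ler_pM => //.
- by rewrite big_seq; apply: sumr_ge0 => t /mem_drop/(allP s0)/ltW.
- by rewrite invr_ge0.
- by rewrite lef_pV2// posrE (lt_le_trans b0).
Qed.

(* The layer-cake majorant of t on t <= 2^m. *)
Definition dyadic_cake (R : realType) (m : nat) (t : R) : R :=
  1 + \sum_(i < m) 2 ^+ i * (2 ^+ i < t)%R%:R.

Lemma dyadic_cake_ge0 (R : realType) m (t : R) : 0 <= dyadic_cake m t.
Proof. by apply: addr_ge0 => //; apply: sumr_ge0 => i _; apply: mulr_ge0. Qed.

(** When [t] lies between 2^m and 2^(m+1), all indicators up to [m] equal 1 and the geometric sum
    gives exactly 2^(m+1). *)
Lemma dyadic_cake_ge (R : realType) m (t : R) : t <= 2 ^+ m -> t <= dyadic_cake m t.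
Proof.
rewrite /dyadic_cake; elim: m => [|m IH]; first by rewrite big_ord0 addr0.
have [/IH tm _|mt tm] := leP t (2 ^+ m).
  by rewrite big_ord_recr/= addrA (le_trans tm)// lerDl mulr_ge0.
apply: le_trans tm _; rewrite (eq_bigr (fun i : 'I_m.+1 => 2 ^+ i)); last first.
  move=> i _; rewrite (_ : (2 ^+ i < t)%R) ?mulr1//; apply: le_lt_trans mt.
  by rewrite ler_eXn2l ?ltr1n// -ltnS.
elim: m.+1 => [|k h]; first by rewrite big_ord0 addr0 expr0.
by rewrite big_ord_recr/= addrA exprS; lra.
Qed.

(** * The measure [nu] on a regular graph in terms of the sorted weights *)

Section Enumeration.
Context {R : realType} {V : finType}.
Variables (w : nat -> R) (x : enumeration V).

Lemma sum_enumeration (P : pred V) (F : V -> R) :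
  \sum_(v | P v) F v = \sum_(j | P (val x j)) F (val x j).
Proof.
rewrite (reindex (val x))//; apply/onW_bij/inj_card_bij; last by rewrite card_ord.
by apply/injectiveP; exact: valP x.
Qed.

Lemma vertex_weight_enumeration (j : 'I_#|V|) :
  vertex_weight w x (val x j) = (decreasing_rearrangement (V := V) w)`_j.
Proof.
rewrite /vertex_weight /codom /image_mem index_map ?index_enum_ord//.
by apply/injectiveP; exact: valP x.
Qed.

Lemma size_decreasing_rearrangement :
  size (decreasing_rearrangement (V := V) w) = #|V|.
Proof. by rewrite size_sort size_mkseq. Qed.

(** The common degree cancels, and read along the enumeration the vertex weights are the sorted
    list, so the complement of the first vertices corresponds to dropping [J] entries. *)
Lemma nu_regular (e : rel V) (k J : nat) :
  (forall v, deg e v = k) -> (0 < k)%N ->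
  let s := decreasing_rearrangement (V := V) w in
  nu e w x (~: first_vertices x (minn J #|V|)) =
    (\sum_(t <- drop J s) t) / (\sum_(t <- s) t).
Proof.
move=> dk k0 s; rewrite /nu.
have k0' : k%:R != 0 :> R by rewrite pnatr_eq0 -lt0n.
have -> : \sum_y (deg e y)%:R * vertex_weight w x y = k%:R * \sum_(t <- s) t.
  rewrite sum_enumeration mulr_sumr (big_nth 0) size_decreasing_rearrangement big_mkord.
  by apply: eq_bigr => j _; rewrite dk vertex_weight_enumeration.
rewrite sum_enumeration -mulr_suml.
rewrite (eq_bigr (fun j : 'I_#|V| => k%:R * s`_j)); last first.
  by move=> j _; rewrite dk vertex_weight_enumeration.
rewrite -mulr_sumr -mulf_div divff// mul1r; congr (_ / _).
rewrite (eq_bigl (fun j : 'I_#|V| => (J <= j)%N)); last first.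
  move=> j; rewrite inE mem_imset; last by apply/injectiveP; exact: valP x.
  by rewrite inE leq_min ltn_ord andbT -leqNgt.
rewrite -(big_mkord (fun j => (J <= j)%N) (nth 0 s)) -big_filter.
have -> : drop J s = [seq s`_j | j <- drop J (iota 0 #|V|)].
  by rewrite map_drop -/(mkseq _ _) -[#|V|]size_decreasing_rearrangement mkseq_nth.
rewrite big_map drop_iota; congr bigop.
have [VJ|JV] := leqP #|V| J.
  rewrite (eqP (_ : #|V| - J == 0)%N) ?subn_eq0//=.
  rewrite (eq_in_filter (a2 := pred0)) ?filter_pred0// => j.
  by rewrite mem_index_iota /= => jV; apply/negbTE; rewrite -ltnNge (leq_trans jV).
rewrite /index_iota subn0 -{1}(subnKC (ltnW JV)) iotaD filter_cat add0n.
rewrite (eq_in_filter (a2 := pred0)); last first.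
  by move=> j; rewrite mem_iota /= add0n => jJ; apply/negbTE; rewrite -ltnNge.
rewrite filter_pred0/= (eq_in_filter (a2 := predT)) ?filter_predT// => j.
by rewrite mem_iota => /andP[].
Qed.

End Enumeration.

(** * Expectation of the tail bound *)

Section ExpectedTail.
Context {d : measure_display} {T : measurableType d} {R : realType}.
Variable P : probability T R.

Lemma expectation_le_simple (I : finType) (a : I -> R) (A : I -> set T) (f : T -> R) :
  (forall i, 0 <= a i) -> (forall i, measurable (A i)) ->
  {ae P, forall om, 0 <= f om <= \sum_i a i * \1_(A i) om} ->
  (0%E <= 'E_P[f] <= \sum_i (a i)%:E * P (A i))%E.
Proof.
move=> a0 mA fA.
have t0 i om : (0 <= (a i)%:E * (\1_(A i) om)%:E)%E by rewrite mule_ge0 ?lee_fin.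
have m1 i : measurable_fun [set: T] (fun om => (\1_(A i) om)%:E : \bar R).
  by apply/measurable_EFinP; exact: measurable_indic.
have mt i : measurable_fun [set: T] (fun om => (a i)%:E * (\1_(A i) om)%:E)%E.
  exact: measurable_funeM.
have -> : (\sum_i (a i)%:E * P (A i) =
    \int[P]_om (\sum_i (a i)%:E * (\1_(A i) om)%:E))%E.
  rewrite ge0_integral_sum//; apply: eq_bigr => i _.
  rewrite ge0_integralZl_EFin//.
  by rewrite (integral_indic P measurableT (mA i)) setIT.
apply: expectation_ae_bounds.
- by move=> om; apply: sume_ge0 => i _.
- exact: emeasurable_sum.
- by apply: filterS fA => om /andP[-> h]; split => //; under eq_bigr do rewrite -EFinM;
    rewrite sumEFin lee_fin.
Qed.

Variables (W : nat -> T -> R) (f : nat -> R).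
Hypothesis mW : forall j, measurable_fun [set: T] (W j).
Hypothesis iW : mutually_independent P W.
Hypothesis fW : forall j k, P [set om | 2 ^+ k < W j om] = (f k)%:E.

Let mWgt j c : measurable [set om | c < W j om].
Proof.
have -> : [set om | c < W j om] = [set: T] `&` W j @^-1` `]c, +oo[.
  by apply/seteqP; split => om /=; rewrite in_itv/= andbT => // -[].
exact: mW.
Qed.

Let mWle j c : measurable (W j @^-1` `]-oo, c]).
Proof. by rewrite -[X in measurable X]setTI; exact: mW. Qed.

Let W_le j k : P (W j @^-1` `]-oo, 2 ^+ k]) = (1 - f k)%:E.
Proof.
have -> : W j @^-1` `]-oo, 2 ^+ k] = ~` [set om | 2 ^+ k < W j om].
  by apply/seteqP; split => om /=; rewrite in_itv/= ?leNgt => /negP.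
by rewrite probability_setC// fW EFinB.
Qed.

(** Independence enters here; the other terms of the bound are linear in indicators of single
    weights. *)
Let all_le N k : P (\bigcap_(j in [set` iota 0 N]) W j @^-1` `]-oo, 2 ^+ k]) =
  ((1 - f k) ^+ N)%:E.
Proof.
rewrite iW ?iota_uniq// (eq_bigr (fun=> (1 - f k)%:E)) => [|j _]; last exact: W_le.
by rewrite prodEFin big_const_seq count_predT size_iota -Monoid.iteropE.
Qed.

Lemma expectation_tail_le (N J m1 m2 : nat) (F : T -> R) :
  {ae P, forall om, 0 <= F om <=
    (\sum_(j < N) (2 ^+ m1 < W j om)%R%:R) / J%:R +
    (all (fun j => W j om <= 2 ^+ m2) (iota 0 N))%:R +
    (\sum_(j < N) dyadic_cake m1 (W j om)) / 2 ^+ m2} ->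
  (0%E <= 'E_P[F] <= (N%:R * f m1 / J%:R + (1 - f m2) ^+ N +
    N%:R * (1 + \sum_(i < m1) 2 ^+ i * f i) / 2 ^+ m2)%:E)%E.
Proof.
move=> FW.
(* The bound is a linear combination of indicators: exceedances of 2^m1, the event that no weight
   exceeds 2^m2, the constant 1 of each layer cake, and its dyadic layers. *)
pose I : finType := ('I_N + ('I_1 + ('I_N + 'I_N * 'I_m1)))%type.
pose a (i : I) : R := match i with
  | inl _ => J%:R^-1 | inr (inl _) => 1 | inr (inr (inl _)) => (2 ^+ m2)^-1
  | inr (inr (inr ji)) => 2 ^+ ji.2 / 2 ^+ m2 end.
pose A (i : I) : set T := match i with
  | inl j => [set om | 2 ^+ m1 < W j om]
  | inr (inl _) => \bigcap_(j in [set` iota 0 N]) W j @^-1` `]-oo, 2 ^+ m2]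
  | inr (inr (inl _)) => [set: T]
  | inr (inr (inr ji)) => [set om | 2 ^+ ji.2 < W ji.1 om] end.
have -> : (N%:R * f m1 / J%:R + (1 - f m2) ^+ N +
    N%:R * (1 + \sum_(i < m1) 2 ^+ i * f i) / 2 ^+ m2)%:E = (\sum_i (a i)%:E * P (A i))%E.
  rewrite !big_sumType big_ord1/= all_le mul1e probability_setT mule1.
  have -> : (\sum_(i < N) J%:R^-1%:E * P [set om | (2 ^+ m1 < W i om)%R] =
     \sum_(i < N) (J%:R^-1 * f m1)%:E)%E by apply: eq_bigr => i _; rewrite fW.
  rewrite -(pair_bigA _ (fun (j : 'I_N) (i : 'I_m1) =>
    ((2 ^+ i / 2 ^+ m2)%:E * P [set om | (2 ^+ i < W j om)%R])%E))/=.
  have -> : (\sum_(j < N) \sum_(i < m1) (2 ^+ i / 2 ^+ m2)%:E *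
      P [set om | (2 ^+ i < W j om)%R] =
     \sum_(j < N) (\sum_(i < m1) 2 ^+ i / 2 ^+ m2 * f i)%:E)%E.
    by apply: eq_bigr => j _; rewrite -sumEFin; apply: eq_bigr => i _; rewrite fW.
  rewrite !sumEFin -!EFinD; congr EFin.
  have sumc (z : R) : \sum_(j < N) z = N%:R * z.
    by rewrite sumr_const card_ord mulr_natl.
  rewrite !sumc -mulrA -mulrA.
  have -> : \sum_(i < m1) 2 ^+ i / 2 ^+ m2 * f i = (\sum_(i < m1) 2 ^+ i * f i) / 2 ^+ m2.
    by rewrite mulr_suml; apply: eq_bigr => i _; rewrite mulrAC.
  by move: (\sum_(i < m1) _) ((2 ^+ m2)^-1) (J%:R^-1) => s u v; ring.
apply: expectation_le_simple.
- by move=> [j|[j|[j|[j i]]]]; rewrite /a ?divr_ge0 ?invr_ge0 ?exprn_ge0.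
- move=> [j|[j|[j|[j i]]]] //=.
  by apply: bigcap_measurableType => // j _.
- apply: filterS FW => om /andP[-> /le_trans]; apply.
  rewrite le_eqVlt; apply/orP; left; apply/eqP.
  have gtE j k : \1_[set om | 2 ^+ k < W j om] om = (2 ^+ k < W j om)%R%:R :> R.
    by rewrite indicE; congr (nat_of_bool _)%:R; apply/idP/idP; rewrite inE.
  rewrite !big_sumType big_ord1/=.
  rewrite -(pair_bigA _ (fun (j : 'I_N) (i : 'I_m1) =>
    2 ^+ i / 2 ^+ m2 * \1_[set om | 2 ^+ i < W j om] om))/=.
  have -> : \1_(\bigcap_(j in [set` iota 0 N]) W j @^-1` `]-oo, 2 ^+ m2]) om =
      (all (fun j => W j om <= 2 ^+ m2) (iota 0 N))%:R :> R.
    rewrite indicE; congr (nat_of_bool _)%:R; apply/idP/allP.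
      by rewrite inE => h j /h /=; rewrite in_itv.
    by move=> h; rewrite inE => j /h /=; rewrite in_itv.
  rewrite mul1r addrA; congr (_ + _ + _).
    by rewrite mulr_suml; apply: eq_bigr => j _; rewrite gtE mulrC.
  rewrite -big_split/= mulr_suml; apply: eq_bigr => j _.
  rewrite indicT/= mulr1 /dyadic_cake mulrDl mul1r; congr (_ + _).
  by rewrite mulr_suml; apply: eq_bigr => i _; rewrite gtE mulrAC.
Qed.

End ExpectedTail.

(** * Tails along powers of two and the choice of thresholds *)

(* Karamata's theorem for truncated means along powers of 2. *)
Lemma dyadic_karamata (R : realType) (f : nat -> R) (k0 : nat) (r : R) :
  1 / 2 < r -> (forall k, (k0 <= k)%N -> 0 < f k /\ r * f k <= f k.+1) ->
  exists2 C, 0 < C & forall m, (k0 <= m)%N ->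
    1 + \sum_(i < m) 2 ^+ i * f i <= C * (2 ^+ m * f m).
Proof.
move=> r2 fr; pose s m := 1 + \sum_(i < m) 2 ^+ i * f i.
have b0 m : (k0 <= m)%N -> 0 < 2 ^+ m * f m.
  by move=> /fr[fm _]; rewrite mulr_gt0// exprn_gt0.
(* The first entry starts the induction at [k0]; the second gives C + 1 <= 2rC, which carries it on
   because 2^m f m grows at least by the factor 2r. *)
pose C := Num.max (s k0 / (2 ^+ k0 * f k0)) (1 / (2 * r - 1)).
have C1 : 1 / (2 * r - 1) <= C by rewrite le_max lexx orbT.
have C2 : s k0 <= C * (2 ^+ k0 * f k0).
  by rewrite -ler_pdivrMr ?b0// le_max lexx.
have C0 : 0 < C by apply: lt_le_trans C1; rewrite divr_gt0//; lra.
exists C => // m k0m; rewrite -/(s m) -(subnKC k0m).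
elim: (m - k0)%N => [|j IH]; first by rewrite addn0.
rewrite addnS /s big_ord_recr/= addrA -/(s _).
have [f0 fS] := fr _ (leq_addr j k0).
apply: le_trans (lerD IH (lexx _)) _.
have h : 1 <= C * (2 * r - 1) by rewrite -ler_pdivrMr//; lra.
have b := b0 _ (leq_addr j k0).
have z0 : 0 < 2 ^+ (k0 + j) :> R by rewrite exprn_gt0.
rewrite exprS; move: (2 ^+ _) z0 fS b => z z0 fS b.
have Cz : 0 <= C * z by rewrite mulr_ge0// ltW.
have h1 := ler_wpM2l Cz fS; have h2 := ler_wpM2l (ltW b) h.
by move: (f _) (f _) h1 h2 => u v h1 h2; lra.
Qed.

(** The product of (1 - p)^N and (1 + p)^N is at most 1, and Bernoulli bounds the latter below by N
    p. *)
Lemma expr_onem_le (R : realFieldType) (p : R) (N : nat) :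
  0 <= p <= 1 -> 0 < N%:R * p -> (1 - p) ^+ N <= (N%:R * p)^-1.
Proof.
move=> /andP[p0 p1] Np; rewrite -[leRHS]mul1r ler_pdivlMr//.
have b := bernoulli N p0; have q0 : 0 <= (1 - p) ^+ N by rewrite exprn_ge0 ?subr_ge0.
apply: le_trans (ler_wpM2l q0 (_ : _ <= (1 + p) ^+ N)) _; first lra.
by rewrite -exprMn exprn_ile1//; nra.
Qed.

(* With k maximal such that 2^n f k >= 1, the three terms are controlled by
   choosing first p, then q >= p, and splitting at 2^(k-q) and 2^(k-p). *)
Lemma dyadic_thresholds (R : realType) (f : nat -> R) (k0 : nat) (r r' : R)
    (J : nat -> nat) (e : R) :
  1 / 2 < r -> r' < 1 -> (forall k, f k <= 1) ->
  (forall k, (k0 <= k)%N -> [/\ 0 < f k, r * f k <= f k.+1 & f k.+1 <= r' * f k]) ->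
  J n @[n --> \oo] --> \oo -> 0 < e ->
  \forall n \near \oo, (0 < J n)%N /\ exists m1 m2,
    (2 ^ n)%:R * f m1 / (J n)%:R + (1 - f m2) ^+ (2 ^ n) +
    (2 ^ n)%:R * (1 + \sum_(i < m1) 2 ^+ i * f i) / 2 ^+ m2 <= e.
Proof.
move=> r2 r'1 f1 fr Joo e0.
have r'0 : 0 < r'.
  have [f0 _ h] := fr _ (leqnn k0); have [f0' _ _] := fr _ (leqnSn k0).
  by rewrite -(pmulr_lgt0 _ f0) (lt_le_trans f0').
have [C C0 sC] := dyadic_karamata r2 (fun k kk => let: And3 a b _ := fr k kk in conj a b).
have lo k j : (k0 <= k)%N -> r ^+ j * f k <= f (k + j)%N.
  move=> kk; elim: j => [|j IH]; first by rewrite addn0 expr0 mul1r.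
  have [_ h _] := fr (k + j)%N (leq_trans kk (leq_addr _ _)).
  by rewrite addnS exprS -mulrA; apply: le_trans h; apply: ler_wpM2l => //; lra.
have hi k j : (k0 <= k)%N -> f (k + j)%N <= r' ^+ j * f k.
  move=> kk; elim: j => [|j IH]; first by rewrite addn0 expr0 mul1r.
  have [_ _ h] := fr (k + j)%N (leq_trans kk (leq_addr _ _)).
  by rewrite addnS exprS -mulrA; apply: (le_trans h); apply: ler_wpM2l => //; exact: ltW.
have e3 : 0 < e / 3 by lra.
have small (x a : R) : 0 <= x < 1 -> 0 < a -> exists j, forall i, (j <= i)%N -> x ^+ i < a.
  move=> /andP[x0 x1] a0; have x1' : `|x| < 1 by rewrite ger0_norm.
  have /cvgrPdist_lt/(_ _ a0)[j _ h] := cvg_expr x1'.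
  by exists j => i /h; rewrite /= sub0r normrN ger0_norm// exprn_ge0.
(* [p] serves the second term, which will be at most r'^p. *)
have [p /(_ _ (leqnn p)) pe] := small r' (e / 3) ltac:(lra) e3.
have t0 : 0 < (2 * r)^-1 by rewrite invr_gt0; lra.
have t1 : (2 * r)^-1 < 1 by rewrite invf_lt1; lra.
have D0 : 0 < 2 * C * 2 ^+ p by rewrite !mulr_gt0// exprn_gt0.
(* [q] serves the third term, which will be at most 2C 2^p (2r)^-q; here 2r > 1. *)
have [q0 qe0] := small (2 * r)^-1 (e / 3 / (2 * C * 2 ^+ p)) ltac:(lra) ltac:(exact: divr_gt0).
pose q := maxn p q0.
have qe : 2 * C * 2 ^+ p * (2 * r)^-1 ^+ q <= e / 3.
  by rewrite mulrC -ler_pdivlMr// ltW// qe0// leq_maxr.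
have pq : (p <= q)%N by rewrite leq_maxl.
have [fK _ _] := fr (k0 + q)%N (leq_addr _ _).
(* The size of [J n] that suffices for the first term, once [q] is fixed. *)
pose A := 2 * 2 ^+ q / (e / 3).
have A0 : 0 <= A by rewrite divr_ge0 ?mulr_ge0 ?exprn_ge0// ltW.
near=> n.
have J0 : (0 < J n)%N by near: n; exact: (cvgnyPgt _).1.
split => //.
have JA : A <= (J n)%:R.
  apply: (le_trans (ltW (archi_boundP A0))); rewrite ler_nat.
  by near: n; exact: (cvgnyPge _).1.
pose N : R := (2 ^ n)%:R; rewrite -/N.
have N0 : 0 < N by rewrite ltr0n expn_gt0.
have NK : 1 <= N * f (k0 + q)%N.
  rewrite -ler_pdivrMr// div1r /N natrX ltW// upper_nthrootP//.
  by near: n; exact: nbhs_infty_ge.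
(* The scale [k] is the least one from [k0 + q] on with N f (k+1) < 1, which exists by geometric
   decay. Starting at [k0 + q] leaves room to step back by [q]. *)
have ex : exists m, (k0 + q <= m)%N && (N * f m.+1 < 1).
  have NK0 : 0 < (N * f (k0 + q)%N)^-1 by rewrite invr_gt0; lra.
  have [j /(_ j.+1 (leqnSn j)) rj] := small r' _ ltac:(lra) NK0.
  exists (k0 + q + j)%N; rewrite leq_addr/= -addnS.
  apply: le_lt_trans (ler_wpM2l (ltW N0) (hi _ j.+1 (leq_addr q k0))) _.
  by rewrite mulrCA -ltr_pdivlMr ?div1r//; lra.
case: (ex_minnP ex) => k /andP[Kk Nk1] kmin.
have Nk : 1 <= N * f k.
  move: Kk; rewrite leq_eqVlt => /predU1P[<-//|Kk].
  have k_gt0 : (0 < k)%N := leq_ltn_trans (leq0n _) Kk.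
  rewrite leNgt; apply/negP => Nk; have := kmin k.-1.
  by rewrite prednK// Nk andbT -ltnS prednK// Kk leqNgt ltn_predL k_gt0 => /(_ isT).
(* One step loses at most the factor r > 1/2, and N f (k+1) < 1. *)
have Nk2 : N * f k < 2.
  have [_ h _] := fr k (leq_trans (leq_addr _ _) Kk).
  have h1 : N * (r * f k) < 1 by apply: le_lt_trans Nk1; apply: ler_wpM2l => //; exact: ltW.
  rewrite mulrCA in h1; move: (N * f k) Nk h1 => X X1 h1.
  have : 0 <= (r - 1 / 2) * X by apply: mulr_ge0; lra.
  lra.
exists (k - q)%N, (k - p)%N.
have qk : (q <= k)%N := leq_trans (leq_addl k0 q) Kk.
have pk : (p <= k)%N := leq_trans pq qk.
have k0m1 : (k0 <= k - q)%N by rewrite -(addnK q k0) leq_sub2r.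
have k0m2 : (k0 <= k - p)%N := leq_trans k0m1 (leq_sub2l _ pq).
have L1 := lo _ q k0m1; rewrite subnK// in L1.
have H2 := hi _ p k0m2; rewrite subnK// in H2.
have S1 := sC _ k0m1.
have [m10 _ _] := fr _ k0m1; have [m20 _ _] := fr _ k0m2.
have r0 : 0 < r by lra.
have rq0 : 0 < r ^+ q by rewrite exprn_gt0.
have NL1 : N * f (k - q)%N <= 2 / r ^+ q.
  rewrite ler_pdivlMr// -mulrA [f _ * _]mulrC ltW//; apply: le_lt_trans Nk2.
  by apply: ler_wpM2l => //; exact: ltW.
(* Stepping back by [q] gives N f (k-q) <= 2 r^-q, and r^-q <= 2^q. *)
have T1 : N * f (k - q)%N / (J n)%:R <= e / 3.
  rewrite ler_pdivrMr ?ltr0n//; apply: (le_trans NL1).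
  rewrite [leRHS]mulrC -ler_pdivrMr//; apply: le_trans JA; rewrite /A.
  apply: ler_wpM2r; first by rewrite invr_ge0 ltW.
  apply: ler_wpM2l => //; rewrite -exprVn; apply: lerXn2r; rewrite ?nnegrE//.
    by rewrite invr_ge0 ltW.
  by rewrite invf_ple ?posrE//; lra.
(* Since 1 <= N f k <= r'^p N f (k-p), the inverse of N f (k-p) is at most r'^p. *)
have T2 : (1 - f (k - p)%N) ^+ (2 ^ n) <= e / 3.
  apply: (@le_trans _ _ (N * f (k - p)%N)^-1).
    by apply: expr_onem_le; rewrite ?f1 ?ltW// mulr_gt0.
  apply: le_trans (ltW pe); rewrite -div1r ler_pdivrMr ?mulr_gt0//.
  by apply: (le_trans Nk); rewrite mulrCA; apply: ler_wpM2l => //; exact: ltW.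
(* The truncated mean is at most C 2^(k-q) f (k-q), so dividing by 2^(k-p) leaves C 2^p 2^-q times N
   f (k-q). *)
have T3 : N * (1 + \sum_(i < k - q) 2 ^+ i * f i) / 2 ^+ (k - p) <= e / 3.
  apply: le_trans qe.
  have E : 2 ^+ (k - q) / 2 ^+ (k - p) = 2 ^+ p / 2 ^+ q :> R.
    apply/eqP; rewrite eqr_div ?expf_neq0// -!exprD.
    by rewrite subnK// subnKC.
  apply: (@le_trans _ _ (N * (C * (2 ^+ (k - q) * f (k - q)%N)) / 2 ^+ (k - p))).
    apply: ler_wpM2r; first by rewrite invr_ge0 exprn_ge0.
    by apply: ler_wpM2l => //; exact: ltW.
  have -> : N * (C * (2 ^+ (k - q) * f (k - q)%N)) / 2 ^+ (k - p) =
      C * (2 ^+ (k - q) / 2 ^+ (k - p)) * (N * f (k - q)%N) by ring.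
  rewrite E exprVn exprMn invfM.
  apply: (@le_trans _ _ (C * (2 ^+ p / 2 ^+ q) * (2 / r ^+ q))).
    apply: ler_wpM2l => //; rewrite mulr_ge0 ?divr_ge0 ?exprn_ge0//; exact: ltW.
  by rewrite le_eqVlt; apply/orP; left; apply/eqP; ring.
lra.
Unshelve. all: by end_near. Qed.

Lemma cvg_expr2n (R : realType) : (2 ^+ k : R) @[k --> \oo] --> +oo.
Proof.
apply/cvgryPge => A; near=> k; apply/ltW/upper_nthrootP.
by near: k; exact: nbhs_infty_ge.
Unshelve. all: by end_near. Qed.

(** Successive ratios of [f] tend to [rho] = 2^-alpha, strictly between 1/2 and 1. The constants [r]
    and [r'] are the midpoints of (1/2, rho) and (rho, 1). *)
Lemma slowly_varying_dyadic (R : realType) (L : R -> R) (alpha : R) :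
  0 < alpha -> alpha < 1 -> slowly_varying L ->
  let f k := L (2 ^+ k) * (2 ^+ k) `^ (- alpha) in
  exists k0 r r', [/\ 1 / 2 < r, r' < 1 & forall k, (k0 <= k)%N ->
    [/\ 0 < f k, r * f k <= f k.+1 & f k.+1 <= r' * f k]].
Proof.
move=> a0 a1 [[b _ Lb] /(_ 2 (ltr0Sn _ 1)) L2] f.
pose rho : R := 2 `^ (- alpha).
have pow1 (c : R) : 0 < c -> 1 < 2 `^ c.
  move=> c0; have := @gt0_ltr_powR R c c0 1 2; rewrite /= powR1; apply.
  - by rewrite nnegrE.
  - by rewrite nnegrE.
  - by rewrite ltr1n.
have rho1 : rho < 1 by rewrite /rho powRN invf_lt1 ?powR_gt0// pow1.
(* Here alpha < 1 enters: 2^alpha times 2^(1-alpha) is 2, and the second factor exceeds 1. *)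
have rho2 : 1 / 2 < rho.
  rewrite /rho powRN div1r ltf_pV2 ?posrE ?powR_gt0//.
  have : 2 `^ alpha * 2 `^ (1 - alpha) = 2.
    by rewrite -powRD ?subrKC ?powRr1//; apply/implyP => _; lra.
  have := pow1 (1 - alpha) ltac:(lra); have := powR_gt0 alpha (ltr0Sn R 1).
  by move: (_ `^ _) (_ `^ _) => X Y X0 Y1 XY; nra.
have lim : L (2 * 2 ^+ k) / L (2 ^+ k) * rho @[k --> \oo] --> rho.
  rewrite -[X in _ --> X]mul1r; apply: cvgM; last exact: cvg_cst.
  exact: (cvg_comp _ _ (@cvg_expr2n R) L2).
have /= nlo := cvgr_gt _ lim _ (_ : (1 / 2 + rho) / 2 < rho).
have /= nhi := cvgr_lt _ lim _ (_ : rho < (1 + rho) / 2).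
have nb : \forall k \near \oo, b <= 2 ^+ k by exact/(cvgryPge _).1/cvg_expr2n.
have [k0 _ h] : \forall k \near \oo, [/\ (1 / 2 + rho) / 2 < L (2 * 2 ^+ k) / L (2 ^+ k) * rho,
    L (2 * 2 ^+ k) / L (2 ^+ k) * rho < (1 + rho) / 2 & b <= 2 ^+ k].
  near=> k; split; near: k => //; [apply: nlo|apply: nhi]; lra.
exists k0, ((1 / 2 + rho) / 2), ((1 + rho) / 2); split; [lra|lra|move=> k /h [h1 h2 h3]].
have L0 := Lb _ h3; have f0 : 0 < f k by rewrite mulr_gt0// powR_gt0// exprn_gt0.
have fS : f k.+1 = L (2 * 2 ^+ k) / L (2 ^+ k) * rho * f k.
  rewrite /f exprS powRM ?exprn_ge0// -/rho.
  by move: (L (2 * _)) (_ `^ _) => u v; field; rewrite gt_eqF.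
by rewrite fS; split => //; apply: ler_wpM2r; exact: ltW.
Unshelve. all: by end_near. Qed.

(** * Vanishing mass outside the heaviest vertices *)

Lemma regular_nu_tail_le (R : realType) (V : finType) (e : rel V) (w : nat -> R)
    (x : enumeration V) (k J m1 m2 : nat) :
  (forall v, deg e v = k) -> (0 < k)%N -> (0 < J)%N ->
  (forall j, (j < #|V|)%N -> 0 < w j) ->
  0 <= nu e w x (~: first_vertices x (minn J #|V|)) <=
    (\sum_(j < #|V|) (2 ^+ m1 < w j)%R%:R) / J%:R +
    (all (fun j => w j <= 2 ^+ m2) (iota 0 #|V|))%:R +
    (\sum_(j < #|V|) dyadic_cake m1 (w j)) / 2 ^+ m2.
Proof.
move=> dk k0 J0 w0; rewrite (nu_regular _ _ _ dk)//.
set s := decreasing_rearrangement _.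
have ps : perm_eq s (mkseq w #|V|) by rewrite perm_sort.
have s0 : all (> 0) s.
  rewrite (perm_all _ ps) all_map; apply/allP => j.
  by rewrite mem_iota => /andP[_ /w0].
have sum_s (F : R -> R) : \sum_(t <- s) F t = \sum_(j < #|V|) F (w j).
  rewrite (perm_big _ ps)/= big_map.
  by rewrite -(big_mkord xpredT (fun j => F (w j))) /index_iota subn0.
apply/andP; split.
  apply: divr_ge0; rewrite big_seq; apply: sumr_ge0 => t.
    by move=> /mem_drop/(allP s0)/ltW.
  by move=> /(allP s0)/ltW.
have ss : sorted >=%O s by apply: sort_sorted => a b; exact: le_total.
apply: le_trans (@tail_ratio_le _ s J (2 ^+ m2) (2 ^+ m1) (dyadic_cake m1) ss s0 J0 _ _ _) _.
- by rewrite exprn_gt0.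
- by move=> t; exact: dyadic_cake_ge0.
- exact: dyadic_cake_ge.
rewrite sum_s (perm_all _ ps) all_map -sum1_count natr_sum big_mkcond/=.
rewrite (eq_bigr (fun t => (2 ^+ m1 < t)%R%:R)) => [|t _]; last by case: ifP.
by rewrite sum_s.
Qed.

(** Suited to bounds whose thresholds depend on [e], where no single dominating sequence is
    given. *)
Lemma cvge0_squeeze_eps (R : realType) (u : nat -> \bar R) :
  (forall e : R, 0 < e -> \forall n \near \oo, (0 <= u n <= e%:E)%E) ->
  u n @[n --> \oo] --> 0%E.
Proof.
move=> ue; apply/fine_cvgP; split.
  have := ue 1 ltr01; apply: filterS => n /andP[u0 u1].
  by rewrite ge0_fin_numE// (le_lt_trans u1)// ltry.
apply/cvgrPdist_le => e e0; have := ue e e0; apply: filterS => n /andP[u0 u1].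
rewrite sub0r normrN ger0_norm ?fine_ge0//.
by rewrite -lee_fin fineK// ge0_fin_numE// (le_lt_trans u1)// ltry.
Qed.

Lemma cvg_trap_mass (R : realType) (alpha : R) (L : R -> R)
    (d : nat -> measure_display) (Om : forall n, measurableType (d n))
    (P : forall n, probability (Om n) R)
    (W : forall n, nat -> {RV (P n) >-> R})
    (x : forall n, Om n -> enumeration (cube n)) (J : nat -> nat) :
  0 < alpha -> alpha < 1 -> slowly_varying L ->
  (forall n, (0 < n)%N -> iid (P n) (fun j => W n j)) ->
  (forall n j, (0 < n)%N -> {ae P n, forall om, 0 < W n j om}) ->
  (forall n t, (0 < n)%N -> 0 < t ->
     P n [set om | t < W n 0%N om] = (L t * t `^ (- alpha))%:E) ->
  J n @[n --> \oo] --> \oo ->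
  ('E_(P n)[fun om => nu (@cube_adj n) (fun j => W n j om) (x n om)
      (~: first_vertices (x n om) (minn (J n) #|cube n|))%SET])%E
    @[n --> \oo] --> 0%E.
Proof.
move=> a0 a1 sL iidW W0 tailW Joo.
pose f k := L (2 ^+ k) * (2 ^+ k) `^ (- alpha).
have fW n j k : (0 < n)%N -> P n [set om | 2 ^+ k < W n j om] = (f k)%:E.
  move=> n0; rewrite /f -(tailW n _ n0) ?exprn_gt0//.
  have E i : [set om | 2 ^+ k < W n i om] = W n i @^-1` `]2 ^+ k, +oo[.
    by apply/seteqP; split => om /=; rewrite in_itv/= andbT.
  by rewrite !E; apply: (iidW n n0).2.
have mW n j : measurable_fun [set: Om n] (W n j) by exact: measurable_funP.
(* [f k] is a probability, as seen in the model with n = 1. *)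
have f1 k : f k <= 1.
  rewrite -lee_fin -(fW 1%N 0%N)// probability_le1//.
  have -> : [set om | 2 ^+ k < W 1%N 0%N om] =
      [set: Om 1%N] `&` W 1%N 0%N @^-1` `]2 ^+ k, +oo[.
    by rewrite setTI; apply/seteqP; split => om /=; rewrite in_itv/= andbT.
  exact: mW.
have [k0 [r [r' [r2 r'1 fr]]]] := slowly_varying_dyadic a0 a1 sL.
apply: cvge0_squeeze_eps => e e0.
near=> n.
have n0 : (0 < n)%N by near: n; exact: nbhs_infty_gt.
have [J0 [m1 [m2 le_e]]] : (0 < J n)%N /\ exists m1 m2,
    (2 ^ n)%:R * f m1 / (J n)%:R + (1 - f m2) ^+ (2 ^ n) +
    (2 ^ n)%:R * (1 + \sum_(i < m1) 2 ^+ i * f i) / 2 ^+ m2 <= e.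
  by near: n; exact: (dyadic_thresholds r2 r'1 f1 fr Joo e0).
have cV : #|cube n| = (2 ^ n)%N by exact: card_cube.
(* Finitely many null sets are merged, so that all weights are positive simultaneously. *)
have Wpos : {ae P n, forall om, forall j : 'I_#|cube n|, 0 < W n j om}.
  by apply: filter_forall => j; exact: W0.
pose F om := nu (@cube_adj n) (fun j => W n j om) (x n om)
  (~: first_vertices (x n om) (minn (J n) #|cube n|))%SET.
have FW : {ae P n, forall om, 0 <= F om <=
    (\sum_(j < #|cube n|) (2 ^+ m1 < W n j om)%R%:R) / (J n)%:R +
    (all (fun j => W n j om <= 2 ^+ m2) (iota 0 #|cube n|))%:R +
    (\sum_(j < #|cube n|) dyadic_cake m1 (W n j om)) / 2 ^+ m2}.
  apply: filterS Wpos => om Wom.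
  exact: (@regular_nu_tail_le _ _ _ (fun j => W n j om) _ n _ _ _ (@deg_cube n) n0 J0
    (fun j jN => Wom (Ordinal jN))).
have /andP[-> h] := expectation_tail_le (mW n) (iidW n n0).1
  (fun j k => fW n j k n0) FW.
by apply: (le_trans h); rewrite lee_fin cV.
Unshelve. all: by end_near. Qed.

(** * The four limits for the hypercube *)

Theorem proposition9p1 (R : realType) (alpha : R) (L : R -> R)
    (d : nat -> measure_display) (Om : forall n, measurableType (d n))
    (P : forall n, probability (Om n) R)
    (W : forall n, nat -> {RV (P n) >-> R})
    (x : forall n, Om n -> enumeration (cube n)) :
  0 < alpha -> alpha < 1 ->
  slowly_varying L ->
  (forall n, (0 < n)%N -> iid (P n) (fun j => W n j)) ->
  (forall n j, (0 < n)%N -> {ae P n, forall om, 0 < W n j om}) ->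
  (forall n t, (0 < n)%N -> 0 < t ->
     P n [set om | t < W n 0%N om] = (L t * t `^ (- alpha))%:E) ->
  (forall n, (0 < n)%N -> uniform_element (P n) (x n)) ->
  (forall n, (0 < n)%N -> independent_of_family (P n) (x n) (fun j => W n j)) ->
  let ell (n : nat) : R := n%:R / 10 in
  [/\ (* (i) *)
      forall X Y : forall n, Om n -> cube n,
        (forall n, (0 < n)%N ->
          [/\ uniform_element (P n) (X n), uniform_element (P n) (Y n) &
              independent_elements (P n) (X n) (Y n)]) ->
        P n [set om |
          ~ rooted_equiv (@cube_adj n)
              (X n om) (gball (@cube_adj n) (X n om) (ell n))
              (Y n om) (gball (@cube_adj n) (Y n om) (ell n))]
          @[n --> \oo] --> 0%E,
      (* (ii) *)
      forall J : nat -> nat,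
        (forall m n, (0 < m)%N -> (m <= n)%N -> (J m <= J n)%N) ->
        J n @[n --> \oo] --> \oo ->
        ('E_(P n)[fun om => nu (@cube_adj n) (fun j => W n j om) (x n om)
            (~: first_vertices (x n om) (minn (J n) #|cube n|))%SET])%E
          @[n --> \oo] --> 0%E,
      (* (iii) *)
      forall X : forall n, Om n -> cube n,
        (forall n, (0 < n)%N -> uniform_element (P n) (X n)) ->
        ('E_(P n)[fun om =>
            (#|gball (@cube_adj n) (X n om) (2 * ell n)|%:R / #|cube n|%:R)%R])%E
          @[n --> \oo] --> 0%E &
      (* (iv) *)
      exists LN : nat -> R,
        [/\ forall m n, (0 < m)%N -> (m < n)%N -> LN m < LN n,
            LN n @[n --> \oo] --> +oo &
            forall X : forall n, Om n -> cube n,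
              (forall n, (0 < n)%N -> uniform_element (P n) (X n)) ->
            forall (d' : nat -> measure_display)
                (Om' : forall n, measurableType (d' n))
                (Q : forall n, cube n -> probability (Om' n) R)
                (S : forall n, nat -> Om' n -> cube n),
              (forall n (y : cube n), (0 < n)%N ->
                 is_markov_chain (Q n y) (lazy_step (@cube_adj n)) y (S n)) ->
            ('E_(P n)[fun om =>
                (\big[Num.max/0]_(y | y \notin gball (@cube_adj n) (X n om) (ell n))
                  fine (Q n y [set om' |
                    (hitting_time (S n) (X n om) om' <=
                       (LN n)%:E * mixing_time (@cube_adj n))%E]))%R])%E
              @[n --> \oo] --> 0%E]].

Proof.
move=> a0 a1 sL iidW W0 tailW _ _ ell; split.
(* The event is empty for every n, all balls of equal radius being isomorphic as rooted graphs. *)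
- move=> X Y _; rewrite [X in X @ _](_ : _ = fun=> 0%E); first exact: cvg_cst.
  apply/funext => n; rewrite [X in P n X](_ : _ = set0) ?measure0//.
  by apply/seteqP; split => // om; apply; exact: cube_rooted_equiv.
- by move=> J _ Joo; exact: (cvg_trap_mass x a0 a1 sL iidW W0 tailW Joo).
- move=> X _; apply: (@cvg_expectation_squeeze _ _ _ _ _ (fun n => (5 / 6) ^+ n)).
    by move=> n om _; rewrite divr_ge0//=; exact: card_gball_cube.
  by apply: cvg_expr; rewrite ger0_norm; lra.
(* L_N = n grows without bound, yet keeps the horizon polynomial in n. *)
- exists (fun n => n%:R); split; [by move=> m n _; rewrite ltr_nat|exact: cvgr_idn|].
  move=> X _ d' Om' Q S SQ.
  apply: (@cvg_expectation_squeeze _ _ _ _ _ (fun n => 4 * 100 ^+ 3 * (99 / 100) ^+ n)).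
    by move=> n om n0; apply: cube_hitting_max_le => // y; exact: SQ.
  rewrite -[X in _ --> X](mulr0 (4 * 100 ^+ 3)); apply: cvgM; first exact: cvg_cst.
  by apply: cvg_expr; rewrite ger0_norm; lra.
Qed.
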